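(* Let $\mathcal{Q}$ be a small quantaloid and $\mathbb{C}$ a cotensored $\mathcal{Q}$-category. Let $X$ be an object of $\mathcal{Q}$ and $(c_i)_{i\in I}$ a (small) family of elements of $\mathbb{C}_X$. If $c$ is a supremum of $(c_i)_{i\in I}$ in the ordered set $\mathbb{C}_X$, then $c$ is also the conical colimit of this family in $\mathbb{C}$.
   Context: A quantaloid is a category whose hom-sets are complete lattices and whose composition preserves arbitrary suprema in each variable separately. For $f\colon X\to Y$ and $g\colon X\to Z$, $\{f,g\}\colon Y\to Z$ is the largest $h$ with $h\circ f\le g$. A $\mathcal{Q}$-category $\mathbb{C}$ consists of a small set $\mathbb{C}_0$ of objects, a type $tx\in\mathcal{Q}_0$ for each $x\in\mathbb{C}_0$, and hom-arrows $\mathbb{C}(y,x)\colon tx\to ty$ with $1_{tx}\le\mathbb{C}(x,x)$ and $\mathbb{C}(z,y)\circ\mathbb{C}(y,x)\le\mathbb{C}(z,x)$. An order is a reflexive transitive relation; $x'\le x$ in $\mathbb{C}$ means $tx'=tx=X$ and $1_X\le\mathbb{C}(x',x)$; $\mathbb{C}_X$ is the ordered set of objects of $\mathbb{C}$ of type $X$. Cotensors: for $f\colon X\to Y$ and $x\in\mathbb{C}_X$, $\langle f,x\rangle$ is (if it exists) an object of type $Y$ with $\mathbb{C}(z,\langle f,x\rangle)=\{f,\mathbb{C}(z,x)\}$ for all $z\in\mathbb{C}_0$. $\mathbb{C}$ is cotensored if all cotensors exist. The conical colimit of a family $(c_i)_{i\in I}$ of objects of type $X$ is (if it exists) an object $c$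 of type $X$ such that $\mathbb{C}(c,y)=\bigwedge_{i\in I}\mathbb{C}(c_i,y)$ in $\mathcal{Q}(ty,X)$ for every $y\in\mathbb{C}_0$. *)

(* Defs.v *)
From HB Require Import structures.
From mathcomp Require Import all_boot all_order.
From mathcomp Require Import boolp classical_sets.

Set Implicit Arguments.
Unset Strict Implicit.
Unset Printing Implicit Defensive.

Import Order.TTheory.
Local Open Scope order_scope.
Local Open Scope classical_set_scope.

(* Hom-sets are [porderType]s, hence carry decidable equality and choice; with
   the classical axioms of [boolp] this is no restriction. Completeness of the
   hom-sets covers arbitrary (in particular empty) subsets, and so does the
   preservation of suprema by composition. *)
Record quantaloid (d : Order.disp_t) := Quantaloid {
  qob :> Type;
  qhom : qob -> qob -> porderType d;
  qcomp : forall X Y Z : qob, qhom Y Z -> qhom X Y -> qhom X Z;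
  qid : forall X : qob, qhom X X;
  qcompA : forall (W X Y Z : qob)
    (h : qhom Y Z) (g : qhom X Y) (f : qhom W X),
    qcomp h (qcomp g f) = qcomp (qcomp h g) f;
  qcomp1l : forall (X Y : qob) (f : qhom X Y), qcomp (qid Y) f = f;
  qcomp1r : forall (X Y : qob) (f : qhom X Y), qcomp f (qid X) = f;
  qcomplete : forall (X Y : qob) (A : set (qhom X Y)),
    exists s, supremums A s;
  qcomp_supl : forall (X Y Z : qob) (A : set (qhom Y Z)) (f : qhom X Y) s,
    supremums A s -> supremums [set qcomp g f | g in A] (qcomp s f);
  qcomp_supr : forall (X Y Z : qob) (g : qhom Y Z) (A : set (qhom X Y)) s,
    supremums A s -> supremums [set qcomp g f | f in A] (qcomp g s)
}.

Arguments qhom {d q} X Y.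
Arguments qcomp {d q X Y Z} g f.
Arguments qid {d q} X.

Notation "g ∘ f" := (qcomp g f) (at level 40, left associativity).

Definition qsup d (Q : quantaloid d) (X Y : Q) (A : set (qhom X Y)) :
  qhom X Y := sval (cid (qcomplete A)).

Lemma qsupP d (Q : quantaloid d) (X Y : Q) (A : set (qhom X Y)) :
  supremums A (qsup A).
Proof. exact: svalP. Qed.

(* The arrow {f, g}: the supremum of all h with h ∘ f <= g, which is the
   largest such h by [qextP]. *)
Definition qext d (Q : quantaloid d) (X Y Z : Q)
    (f : qhom X Y) (g : qhom X Z) : qhom Y Z :=
  qsup [set h : qhom Y Z | h ∘ f <= g].

Lemma qextP d (Q : quantaloid d) (X Y Z : Q) (f : qhom X Y) (g : qhom X Z) :
  qext f g ∘ f <= g /\ forall h : qhom Y Z, h ∘ f <= g -> h <= qext f g.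
Proof.
have [ubA lubA] := qsupP [set h : qhom Y Z | h ∘ f <= g].
split=> [|h hf]; last exact: ubA.
have [_] := qcomp_supl f (conj ubA lubA : supremums _ _).
by apply=> _ [h hf <-].
Qed.

(* [chom y x] is the hom-arrow C(y, x) : tx -> ty. *)
Record qcategory d (Q : quantaloid d) := QCategory {
  cob :> Type;
  ctype : cob -> Q;
  chom : forall y x : cob, qhom (ctype x) (ctype y);
  chom1 : forall x : cob, qid (ctype x) <= chom x x;
  chomM : forall z y x : cob, chom z y ∘ chom y x <= chom z x
}.

Definition ob_at d (Q : quantaloid d) (C : qcategory Q) (X : Q) : Type :=
  {x : C | ctype x = X}.

Definition at_type d (Q : quantaloid d) (C : qcategory Q) (x : C) :
  ob_at C (ctype x) := exist _ x erefl.

(* C(y, x) for objects x and y of given types, transported along the equations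
   tx = X and ty = Y. *)
Definition hom_at d (Q : quantaloid d) (C : qcategory Q) (X Y : Q)
    (y : ob_at C Y) (x : ob_at C X) : qhom X Y :=
  let: exist y0 ey := y in let: exist x0 ex := x in
  match ex in _ = X', ey in _ = Y' return qhom X' Y' with
  | erefl, erefl => chom y0 x0
  end.

Lemma hom_at1 d (Q : quantaloid d) (C : qcategory Q) (X : Q)
    (x : ob_at C X) : qid X <= hom_at x x.
Proof. by case: x => x e; case: X / e; exact: chom1. Qed.

Lemma hom_atM d (Q : quantaloid d) (C : qcategory Q) (X Y Z : Q)
    (z : ob_at C Z) (y : ob_at C Y) (x : ob_at C X) :
  hom_at z y ∘ hom_at y x <= hom_at z x.
Proof.
case: z y x => [z ez] [y ey] [x ex].
case: Z / ez; case: Y / ey; case: X / ex; exact: chomM.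
Qed.

Lemma qcomp_mono d (Q : quantaloid d) (X Y Z : Q) (g g' : qhom Y Z)
    (f f' : qhom X Y) : g <= g' -> f <= f' -> g ∘ f <= g' ∘ f'.
Proof.
move=> gg' ff'.
have supg : supremums [set g; g'] g'.
  by split=> [_ [->|->] //|h]; apply; right.
have supf : supremums [set f; f'] f'.
  by split=> [_ [->|->] //|h]; apply; right.
have [le1 _] := qcomp_supl f supg; have [le2 _] := qcomp_supr g' supf.
apply: (@le_trans _ _ (g' ∘ f)); first by apply: le1; exists g => //; left.
by apply: le2; exists f => //; left.
Qed.

(* The ordered set C_X: x' <= x iff 1_X <= C(x', x). *)
Definition ob_at_le d (Q : quantaloid d) (C : qcategory Q) (X : Q) :
  rel (ob_at C X) := fun x' x => qid X <= hom_at x' x.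

Lemma ob_at_le_refl d (Q : quantaloid d) (C : qcategory Q) (X : Q) :
  reflexive (@ob_at_le d Q C X).
Proof. exact: hom_at1. Qed.

Lemma ob_at_le_trans d (Q : quantaloid d) (C : qcategory Q) (X : Q) :
  transitive (@ob_at_le d Q C X).
Proof.
move=> y x z xy yz; apply: le_trans (hom_atM x y z).
by rewrite -[qid X]qcomp1l; exact: qcomp_mono.
Qed.

Section Fiber.
Variables (d : Order.disp_t) (Q : quantaloid d) (C : qcategory Q) (X : Q).

HB.instance Definition _ := gen_eqMixin (ob_at C X).
HB.instance Definition _ := gen_choiceMixin (ob_at C X).
HB.instance Definition _ := Order.Le_isPreorder.Build d (ob_at C X)
  (@ob_at_le_refl d Q C X) (@ob_at_le_trans d Q C X).

End Fiber.

(* [supremums] requires antisymmetry, which the order on [ob_at C X] lacks. *)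
Definition is_supremum d (T : preorderType d) (I : Type) (c : I -> T) (s : T) :=
  (forall i, c i <= s) /\ (forall b, (forall i, c i <= b) -> s <= b).

Definition is_cotensor d (Q : quantaloid d) (C : qcategory Q) (X Y : Q)
    (f : qhom X Y) (x : ob_at C X) (w : ob_at C Y) :=
  forall z : C, hom_at (at_type z) w = qext f (hom_at (at_type z) x).

Definition cotensored d (Q : quantaloid d) (C : qcategory Q) :=
  forall (X Y : Q) (f : qhom X Y) (x : ob_at C X),
    exists w : ob_at C Y, is_cotensor f x w.

Definition is_conical_colimit d (Q : quantaloid d) (C : qcategory Q) (X : Q)
    (I : Type) (c : I -> ob_at C X) (s : ob_at C X) :=
  forall y : C, infimums [set hom_at (c i) (at_type y) | i in [set: I]]
                  (hom_at s (at_type y)).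

(* Main.v *)
Require Import Defs.
From mathcomp Require Import all_boot all_order.

Set Implicit Arguments.
Unset Strict Implicit.
Unset Printing Implicit Defensive.

Import Order.TTheory.
Local Open Scope order_scope.

(** Cotensors turn inequalities between arrows into inequalities between
    objects. Let [f : ty -> X] be an arrow and [w] the cotensor of [f] and [y].
    For every [z] of type [X],
      [f <= C(z, y)]  iff  [1_X <= {f, C(z, y)} = C(z, w)]  iff  [z <= w]
    ([le_cotensor]). So if [f] is a lower bound of the arrows [C(c_i, y)], then
    [w] is an upper bound of the [c_i] in the fibre [C_X]; hence [s <= w], and
    the same equivalence, read backwards at [s], gives [f <= C(s, y)]. That
    [C(s, y)] is itself a lower bound holds without cotensors, because
    [C(-, y)] reverses the order of the fibre ([hom_at_anti]). *)

Lemma le_qext d (Q : quantaloid d) (X Y Z : Q)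
    (f : qhom X Y) (g : qhom X Z) (h : qhom Y Z) :
  (h <= qext f g) = (h ∘ f <= g).
Proof.
have [ext_le ext_max] := qextP f g.
apply/idP/idP=> [h_le|]; last exact: ext_max.
by apply: le_trans ext_le; exact: qcomp_mono.
Qed.

Lemma hom_at_anti d (Q : quantaloid d) (C : qcategory Q) (X Y : Q)
    (x' x : ob_at C X) (y : ob_at C Y) :
  x' <= x -> hom_at x y <= hom_at x' y.
Proof.
move=> x'x; apply: le_trans (hom_atM x' x y).
by rewrite -[hom_at x y in leLHS]qcomp1l; exact: qcomp_mono.
Qed.

(** The defining equation of a cotensor is indexed by bare objects of [C];
    this is its form for objects of a prescribed type. *)
Lemma hom_at_cotensor d (Q : quantaloid d) (C : qcategory Q) (X Y Z : Q)
    (f : qhom X Y) (x : ob_at C X) (w : ob_at C Y) (z : ob_at C Z) :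
  is_cotensor f x w -> hom_at z w = qext f (hom_at z x).
Proof. by case: z => z ez fxw; case: Z / ez; exact: fxw. Qed.

(** Both sides say that the identity arrow lies below [{f, C(z, x)}]. Thus the
    cotensor is the largest object [z] of its fibre with [f <= C(z, x)]. *)
Lemma le_cotensor d (Q : quantaloid d) (C : qcategory Q) (X Y : Q)
    (f : qhom X Y) (x : ob_at C X) (w z : ob_at C Y) :
  is_cotensor f x w -> (z <= w) = (f <= hom_at z x).
Proof.
move=> fxw; rewrite -[z <= w]/(qid Y <= hom_at z w).
by rewrite (hom_at_cotensor z fxw) le_qext qcomp1l.
Qed.

Theorem proposition2p10 (d : Order.disp_t) (Q : quantaloid d)
    (C : qcategory Q) (hC : cotensored C)
    (X : Q) (I : Type) (c : I -> ob_at C X) (s : ob_at C X)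
    (hs : is_supremum c s) :
  is_conical_colimit c s.
Proof.
have [c_le_s s_min] := hs.
move=> y; split=> [_ [i _ <-]|f f_lb]; first exact: hom_at_anti.
have [w fyw] := hC _ _ f (at_type y).
rewrite -(le_cotensor s fyw); apply: s_min => i.
by rewrite (le_cotensor (c i) fyw); apply: f_lb; exists i.
Qed.
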